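(* Let $\Omega$ be a nonempty topological space and endow $\Omega^2=\Omega\times\Omega$ with the product topology. Suppose that $k:\Omega^2\to\mathbb{C}$ is a positive definite kernel on $\Omega$ whose real part $\Re(k)$ is continuous on the diagonal $\mathcal{D}(\Omega^2)=\{(x,x):x\in\Omega\}$. Then $k$ is continuous in $\Omega^2$.
   Context: A function $k:\Omega\times\Omega\to\mathbb{C}$ is a positive definite kernel on a nonempty set $\Omega$ if, for every $n\in\mathbb{N}$ and all finite collections $\{x_j\}_{j=1}^n\subset\Omega$ and $\{\xi_j\}_{j=1}^n\subset\mathbb{C}$, one has $\sum_{i,j=1}^n k(x_i,x_j)\,\xi_i\,\overline{\xi_j}\ge 0$ (i.e. the sum is real and nonnegative). ''$\Re(k)$ is continuous on the diagonal'' means that $\Re(k)$, as a function on $\Omega^2$, is continuous at every point of $\mathcal{D}(\Omega^2)$. *)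

(* Defs.v *)
From HB Require Import structures.
From mathcomp Require Import all_boot all_order all_algebra.
From mathcomp Require Import all_classical all_reals all_analysis.
From mathcomp Require Import complex.

Set Implicit Arguments.
Unset Strict Implicit.
Unset Printing Implicit Defensive.

Import Order.TTheory GRing.Theory Num.Theory.
Import numFieldNormedType.Exports.

Local Open Scope ring_scope.

(* In the numeric field [R[i]], [0 <= z] means that [z] is real and
   nonnegative. The points [x i] need not be distinct. The codomain is written
   [R[i]^o] because that alias carries the topology of the modulus. *)
Definition positive_definite_kernel (R : realType) (Omega : Type)
    (k : Omega * Omega -> R[i]^o) : Prop :=
  forall (n : nat) (x : 'I_n -> Omega) (xi : 'I_n -> R[i]),
    0 <= \sum_(i < n) \sum_(j < n) (k (x i, x j) : R[i]) * xi i * (xi j)^*.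

(* Main.v *)
Require Import Defs.
From HB Require Import structures.
From mathcomp Require Import all_boot all_order all_algebra.
From mathcomp Require Import all_classical all_reals all_analysis.
From mathcomp Require Import complex.
From mathcomp Require Import ring lra.

(** Positivity on three points controls the increments of [k] everywhere by
    its real part near the diagonal:
    [`|k(u,x) - k(u,y)|^2 <= (1 + k(u,u)) * (k(x,x) + k(y,y) - 2 Re k(x,y))].
    In terms of a feature map [phi] with [k(x,y) = <phi x, phi y>], this is the
    Cauchy-Schwarz inequality for [phi u] and [phi x - phi y], slightly
    weakened by the factor [1 + k(u,u)] in place of [k(u,u)]; it is proved
    directly in [positive_definite_kernel_increment], by applying positivity to
    the points [x, y, u] with coefficients [1, -1, c] for one well-chosen [c].

    The second factor vanishes when [x = y] and involves only [Re k] at points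
    near the diagonal, so it tends to 0 as [x] tends to [y]
    ([continuous_Re_increment]). To compare [k] at [(x,y)] and [(a,b)], pass
    through [(a,y)]. The step from [(a,y)] to [(a,b)] is an increment with [u]
    fixed at [a]. By hermitian symmetry the step from [(x,y)] to [(a,y)] is an
    increment with [u = y], which moves, but [k(y,y)] is real and converges to
    [k(b,b)]. *)

Set Implicit Arguments.
Unset Strict Implicit.
Unset Printing Implicit Defensive.

Import Order.TTheory GRing.Theory Num.Theory.
Import numFieldNormedType.Exports.

Local Open Scope classical_set_scope.
Local Open Scope ring_scope.

Lemma positive_definite_kernel_diag_ge0 (R : realType) (Omega : Type)
    (k : Omega * Omega -> R[i]^o) (x : Omega) :
  positive_definite_kernel k -> 0 <= (k (x, x) : R[i]).
Proof.
by move=> /(_ 1 (fun=> x) (fun=> 1)); rewrite !big_ord1 rmorph1 !mulr1.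
Qed.

Lemma positive_definite_kernel2 (R : realType) (Omega : Type)
    (k : Omega * Omega -> R[i]^o) (x y : Omega) (a b : R[i]) :
  positive_definite_kernel k ->
  0 <= (k (x, x) : R[i]) * a * a^* + (k (x, y) : R[i]) * a * b^*
     + ((k (y, x) : R[i]) * b * a^* + (k (y, y) : R[i]) * b * b^*).
Proof.
move=> /(_ 2 (tnth [tuple x; y]) (tnth [tuple a; b])).
by rewrite !big_ord_recl !big_ord0 !addr0.
Qed.

Lemma positive_definite_kernel3 (R : realType) (Omega : Type)
    (k : Omega * Omega -> R[i]^o) (x y z : Omega) (a b c : R[i]) :
  positive_definite_kernel k ->
  0 <= (k (x, x) : R[i]) * a * a^* + (k (x, y) : R[i]) * a * b^*
     + (k (x, z) : R[i]) * a * c^* + ((k (y, x) : R[i]) * b * a^*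
     + (k (y, y) : R[i]) * b * b^* + (k (y, z) : R[i]) * b * c^*)
     + ((k (z, x) : R[i]) * c * a^* + (k (z, y) : R[i]) * c * b^*
     + (k (z, z) : R[i]) * c * c^*).
Proof.
move=> /(_ 3 (tnth [tuple x; y; z]) (tnth [tuple a; b; c])).
by rewrite !big_ord_recl !big_ord0 !addr0 /= !addrA.
Qed.

(** Polarization: the values of the form at the coefficients [(1, 1)] and
    [(1, i)] are real, which fixes the imaginary part of [k(x,y) + k(y,x)] and
    the real part of [k(x,y) - k(y,x)]. *)
Lemma positive_definite_kernel_hermitian (R : realType) (Omega : Type)
    (k : Omega * Omega -> R[i]^o) (x y : Omega) :
  positive_definite_kernel k -> (k (y, x) : R[i]) = (k (x, y) : R[i])^*.
Proof.
move=> k_pd.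
have := positive_definite_kernel2 x y 1 'i%C k_pd.
have := positive_definite_kernel2 x y 1 1 k_pd.
have := positive_definite_kernel_diag_ge0 y k_pd.
have := positive_definite_kernel_diag_ge0 x k_pd.
case: (k (x, x)) => a1 a2; case: (k (y, y)) => b1 b2.
case: (k (x, y)) => c1 c2; case: (k (y, x)) => d1 d2 /=.
rewrite !lecE /= => /andP[/eqP-> _] /andP[/eqP-> _] /andP[/eqP h1 _].
by move=> /andP[/eqP h2 _]; congr (_ +i* _)%C; lra.
Qed.

(** A weak discriminant bound. The minimizer [c = - K^-1 * v^*] would give
    [`|v|^2 <= K * D] but needs [K != 0]; taking [c = - (1 + K)^-1 * v^*]
    treats all [K >= 0] at once, at the price of the constant [1 + K]. *)
Lemma quadratic_ge0_sqr_norm_le (C : numClosedFieldType) (D K v : C) :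
  0 <= K ->
  (forall c : C, 0 <= D + (v * c + (v * c)^*) + K * (c * c^*)) ->
  `|v| ^+ 2 <= (1 + K) * D.
Proof.
move=> K0 h; pose t := (1 + K)^-1.
have K1 : 0 < 1 + K by rewrite ltr_pwDl.
have t0 : 0 < t by rewrite invr_gt0.
have tJ : t^* = t by apply/CrealP/ger0_real/ltW.
have tK : t * (1 + K) = 1 by rewrite mulVf ?gt_eqF.
have cJ : (- t * v^*)^* = - t * v by rewrite rmorphM rmorphN /= conjCK tJ.
have tV : t * (v * v^*) <= D.
  rewrite -subr_ge0; apply: (le_trans (h (- t * v^*))); rewrite -subr_ge0.
  rewrite rmorphM /= cJ (_ : _ - _ = t * t * (v * v^*)).
    by rewrite -normCK !mulr_ge0// ltW.
  (* The quadratic form at this [c] is [D - t|v|^2 - t^2|v|^2]. *)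
  transitivity (t * (v * v^*) - t * (t * (1 + K)) * (v * v^*)
    + t * t * (v * v^*)); first by ring.
  by rewrite tK mulr1 subrr add0r.
by rewrite normCK -ler_pdivrMl.
Qed.

(** The Cauchy-Schwarz type bound on which the theorem rests. The right-hand
    side is written with real parts, on which continuity is assumed; the
    diagonal values are real, and the [2 * Re k(x,y)] is the sum of the cross
    terms [k(x,y)] and [k(y,x)]. *)
Lemma positive_definite_kernel_increment (R : realType) (Omega : Type)
    (k : Omega * Omega -> R[i]^o) (u x y : Omega) :
  positive_definite_kernel k ->
  `|(k (u, x) : R[i]) - k (u, y)| ^+ 2
  <= ((1 + complex.Re (k (u, u)))
     * (complex.Re (k (x, x)) + complex.Re (k (y, y))
        - 2 * complex.Re (k (x, y))))%:C%C.
Proof.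
move=> k_pd.
have reK z : ((complex.Re (k (z, z)))%:C)%C = k (z, z).
  exact/RRe_real/ger0_real/positive_definite_kernel_diag_ge0.
have re2 : ((2 * complex.Re (k (x, y)))%:C)%C
    = (k (x, y) : R[i]) + (k (x, y) : R[i])^*.
  rewrite mulr2n mulrDl mul1r; case: (k (x, y)) => c1 c2.
  by congr (_ +i* _)%C; rewrite subrr.
rewrite rmorphM rmorphB !rmorphD rmorph1 /= !reK re2.
apply: quadratic_ge0_sqr_norm_le.
  exact: positive_definite_kernel_diag_ge0.
move=> c; have := positive_definite_kernel3 x y u 1 (-1) c k_pd.
rewrite (positive_definite_kernel_hermitian u x k_pd).
rewrite (positive_definite_kernel_hermitian u y k_pd).
rewrite (positive_definite_kernel_hermitian x y k_pd).
rewrite rmorphN rmorphM rmorphB rmorph1 /=.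
by congr (0 <= _); ring.
Qed.

Lemma continuous_Re_increment (R : realType) (Omega : topologicalType)
    (k : Omega * Omega -> R[i]^o) (a : Omega) :
  {for (a, a), continuous (fun p : Omega * Omega => complex.Re (k p) : R)} ->
  (complex.Re (k (x, x)) + complex.Re (k (a, a)) - 2 * complex.Re (k (x, a)))
    @[x --> a] --> (0 : R).
Proof.
move=> ca.
have c1 : (fun x : Omega => (x, x)) x @[x --> a] --> (a, a).
  by apply: cvg_pair; exact: cvg_id.
have c2 : (fun x : Omega => (x, a)) x @[x --> a] --> (a, a).
  by apply: cvg_pair; [exact: cvg_id|exact: cvg_cst].
have -> : 0 = complex.Re (k (a, a)) + complex.Re (k (a, a))
   - 2 * complex.Re (k (a, a)) :> R by rewrite mulr2n mulrDl mul1r subrr.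
apply: cvgB.
  by apply: cvgD; [exact: (cvg_comp _ _ c1 ca)|exact: cvg_cst].
by apply: cvgMr; exact: (cvg_comp _ _ c2 ca).
Qed.

(** Turns a real bound on a squared modulus into a bound on the modulus in the
    order of [R[i]], the one in which the topology of [R[i]^o] is defined. *)
Lemma ltc_norm_sqr (R : realType) (z : R[i]) (r e : R) :
  0 < e -> `|z| ^+ 2 <= r%:C%C -> r < e ^+ 2 -> `|z| < e%:C%C.
Proof.
move=> e0 zr re; rewrite -(@ltr_pXn2r _ 2)// ?nnegrE ?normr_ge0 ?ler0c ?ltW//.
by rewrite (le_lt_trans zr)// -rmorphXn ltcR.
Qed.

Theorem theorem2p3 (R : realType) (Omega : topologicalType)
    (Omega_nonempty : [set: Omega] !=set0)
    (k : Omega * Omega -> R[i]^o)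
    (k_pd : positive_definite_kernel k)
    (Rek_cont : forall x : Omega,
      {for (x, x), continuous (fun p : Omega * Omega => complex.Re (k p) : R)}) :
  continuous k.
Proof.
move=> [a b].
apply/cvgrPdist_lt => e e0.
(* Each of the two steps through [(a, p.2)] is allowed half of [e]. *)
have [r r0 ->] : exists2 r : R, 0 < r & e = (r + r)%:C%C.
  exists (complex.Re e / 2).
    by rewrite divr_gt0//; move: e0; rewrite ltcE /= => /andP[].
  by rewrite -splitr RRe_real// gtr0_real.
have r2 : 0 < r ^+ 2 by rewrite exprn_gt0.
pose D x y := complex.Re (k (x, x)) + complex.Re (k (y, y))
              - 2 * complex.Re (k (x, y)).
have Da : (fun p : Omega * Omega => D p.1 a) p @[p --> (a, b)] --> (0 : R).
  exact: (cvg_comp _ _ cvg_fst (continuous_Re_increment (Rek_cont a))).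
have Db : (fun p : Omega * Omega => D p.2 b) p @[p --> (a, b)] --> (0 : R).
  exact: (cvg_comp _ _ cvg_snd (continuous_Re_increment (Rek_cont b))).
have kyy : (fun p : Omega * Omega => 1 + complex.Re (k (p.2, p.2))) p
    @[p --> (a, b)] --> 1 + complex.Re (k (b, b)).
  apply: cvgD; first exact: cvg_cst.
  have c2 : (fun p : Omega * Omega => (p.2, p.2)) p @[p --> (a, b)] --> (b, b).
    by apply: cvg_pair; exact: cvg_snd.
  exact: (cvg_comp _ _ c2 (Rek_cont b)).
have F1 : (1 + complex.Re (k (p.2, p.2))) * D p.1 a
    @[p --> (a, b)] --> (0 : R).
  by rewrite -(mulr0 (1 + complex.Re (k (b, b)))); exact: cvgM.
have F2 : (1 + complex.Re (k (a, a))) * D p.2 b @[p --> (a, b)] --> (0 : R).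
  by rewrite -(mulr0 (1 + complex.Re (k (a, a)))); exact: cvgMr.
apply: (filterS2 _ _ (cvgr_lt 0 F1 _ r2) (cvgr_lt 0 F2 _ r2)) => p n1 n2.
have i1 := positive_definite_kernel_increment p.2 p.1 a k_pd.
have i2 := positive_definite_kernel_increment a p.2 b k_pd.
have {i1 n1}l1 := ltc_norm_sqr r0 i1 n1.
have {i2 n2}l2 := ltc_norm_sqr r0 i2 n2.
rewrite rmorphD distrC (_ : k p - k (a, b) =
  (k p - k (a, p.2)) + (k (a, p.2) - k (a, b))); last by rewrite subrKA.
apply: (le_lt_trans (ler_normD _ _)); apply: ltrD => //.
move: l1; rewrite -norm_conjC rmorphB /=.
rewrite -(positive_definite_kernel_hermitian p.2 p.1 k_pd).
by rewrite -(positive_definite_kernel_hermitian p.2 a k_pd) -surjective_pairing.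
Qed.
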